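(* Let $\mathbb{E}$ be a finite-dimensional real vector space of dimension $d$, and let $n\ge 1$, $N\geq 0$ be integers. Consider a class $\mathcal{F}_K(\mathbb{E})$ of composite objective functions $F=\sum_{k=1}^n F^{(k)}$ with $F^{(k)}\in\mathcal{F}_k(\mathbb{E})$ for $k\in K=\{1,\dots,n\}$, a first-order method $\mathcal{M}$, a performance measure $\mathcal{P}$ and an initialization condition $\mathcal{I}$, all of which are Gram-representable. Let $w$ be the worst-case value for criterion $\mathcal{P}$ of method $\mathcal{M}$ after $N$ iterations on objective functions in $\mathcal{F}_K(\mathbb{E})$ with initialization condition $\mathcal{I}$, i.e. the optimal value of the performance estimation problem (PEP) defined in the context. Then: (i) If $d\geq (n+1)(N+2)$, computing $w$ can be formulated as a convex program in the variables $F_N\in\mathbb{R}^{n(N+2)}$ and $G_N\in\mathbb{S}^{(n+1)(N+2)}$, namely: maximize the concave function representing $\mathcal{P}$ subject to the convex constraints representing $\mathcal{F}_K(\mathbb{E})$, $\mathcal{M}$, $\mathcal{I}$ and the optimality of $x_*$, together with $G_N\succeq 0$. (Here ''formulated as'' means that the feasible pairs $(F_N,G_N)$ of the program are exactly the pairs arising from feasible points of (PEP), with the same objective values; in particular the optimal values are equal.) (ii) Otherwise (if $d<(n+1)(N+2)$), computing $w$ can be formulated, in the same sense, as the same convex program with the additional nonconvex constraint $\operatorname{Rank} G_N\leq d$. (iii) If in addition $\mathcal{F}_K(\mathbb{E})$, $\mathcal{M}$, $\mathcal{P}$ and $\mathcal{I}$ are linearly Gram-representable, then the convex program is a semidefinite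 program of the form $$\sup_{F_N\in\mathbb{R}^{n(N+2)},\,G_N\in\mathbb{S}^{(n+1)(N+2)}} c^\top F_N+\operatorname{Tr}(CG_N)\quad\text{subject to}\quad a_i+b_i^\top F_N+\operatorname{Tr}(D_iG_N)\leq 0\ \ \forall i\in S,\qquad G_N\succeq 0,$$ for some finite index set $S$ and some data $a_i\in\mathbb{R}$, $b_i,c\in\mathbb{R}^{n(N+2)}$, $D_i,C\in\mathbb{S}^{(n+1)(N+2)}$.
   Context: Setting. $\mathbb{E}$ is a real vector space of dimension $d$, $\mathbb{E}^*$ its dual, $\langle\cdot,\cdot\rangle:\mathbb{E}^*\times\mathbb{E}\to\mathbb{R}$ a dual pairing (nondegenerate bilinear map), $B:\mathbb{E}\to\mathbb{E}^*$ a self-adjoint positive definite linear operator, and $\langle s,t\rangle_{\mathbb{E}^*}=\langle s,B^{-1}t\rangle$ for $s,t\in\mathbb{E}^*$. $\mathbb{S}^m$ is the space of symmetric $m\times m$ real matrices. Each $\mathcal{F}_k(\mathbb{E})$ is a class of convex functions $\mathbb{E}\to\mathbb{R}\cup\{\infty\}$. Let $I=\{0,1,\dots,N,*\}$. A set of triples $\{(x_i,g_i,f_i)\}_{i\in I}$ with $x_i\in\mathbb{E}$, $g_i\in\mathbb{E}^*$, $f_i\in\mathbb{R}$ is $\mathcal{F}(\mathbb{E})$-interpolable if there is $F\in\mathcal{F}(\mathbb{E})$ with $F(x_i)=f_i$ and $g_i\in\partial F(x_i)$ for all $i\in I$. A first-order method $\mathcal{M}$ is described by equations $(\mathrm{EQ}_i)$,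 $1\le i\le N$, where $(\mathrm{EQ}_i)$ is an equation relating $x_0,\dots,x_i$ and the first-order oracle outputs $(f_j^{(k)},g_j^{(k)})$, $0\le j\le i$, $k\in K$, which (implicitly) defines $x_i$. A performance measure $\mathcal{P}$ is a real-valued function of $\{(f^{(k)}_i,g^{(k)}_i)\}_{i\in I,k\in K}$ and $\{x_i\}_{i\in I}$ (lower is better). An initialization condition $\mathcal{I}$ is a condition on the initial iterate $x_0$, which may involve the oracle outputs and $x_*$. The performance estimation problem (PEP) is: maximize (supremum) $\mathcal{P}$ over all $\{x_i\}_{i\in I}\subset\mathbb{E}$ and $\{(f_i^{(k)},g_i^{(k)})\}_{i\in I,k\in K}\subset\mathbb{R}\times\mathbb{E}^*$ such that: for each $k\in K$, $\{(x_i,g_i^{(k)},f_i^{(k)})\}_{i\in I}$ is $\mathcal{F}_k(\mathbb{E})$-interpolable; $\mathcal{I}$ holds; $(\mathrm{EQ}_i)$ holds for all $1\le i\le N$; and $x_*$ is optimal for $F$, which is expressed as $\sum_{k\in K}g_*^{(k)}=0$ (equivalently $\big\langle\sum_k g_*^{(k)},\sum_k g_*^{(k)}\big\rangle_{\mathbb{E}^*}=0$). Gram representation. To such a point associate the list $P_N$ of $(n+1)(N+2)$ elements of $\mathbb{E}^*$ $$P_N=[Bx_0,\dots,Bx_N,\ Bx_*,\ g_0^{(1)},\dots,g_0^{(n)},\ \dots,\ g_N^{(1)},\dots,g_N^{(n)},\ g_*^{(1)},\dots,g_*^{(n)}],$$ the vector $F_N=[f_0^{(1)},\dots,f_0^{(n)},\dots,f_N^{(1)},\dots,f_N^{(n)},f_*^{(1)},\dots,f_*^{(n)}]\in\mathbb{R}^{n(N+2)}$,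 and the Gram matrix $G_N\in\mathbb{S}^{(n+1)(N+2)}$ whose $(i,j)$ entry is the $\langle\cdot,\cdot\rangle_{\mathbb{E}^*}$-product of the $i$th and $j$th elements of $P_N$. Definitions. A class of functions is Gram-representable (resp. linearly Gram-representable) if its interpolation conditions can be formulated using a finite number of convex (resp. linear, i.e. affine) constraints involving only $G_N$ and $F_N$; $\mathcal{F}_K(\mathbb{E})$ is (linearly) Gram-representable if each $\mathcal{F}_k(\mathbb{E})$, $k\in K$, is. A performance measure is Gram-representable (resp. linearly) if it can be expressed as a concave (resp. linear) function of $G_N$ and $F_N$ only. An initialization condition is Gram-representable (resp. linearly) if it can be expressed using a finite number of convex (resp. linear) constraints involving only $G_N$ and $F_N$. A first-order method is Gram-representable (resp. linearly) if the computation of its iterates, i.e. the equations $(\mathrm{EQ}_i)$, can be expressed using a finite number of convex (resp. linear) constraints involving only $G_N$ and $F_N$. *)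

(* Defs.v *)
From Stdlib Require List.
From HB Require Import structures.
From mathcomp Require Import all_boot all_order all_algebra.
From mathcomp Require Import boolp classical_sets reals ereal.

Set Implicit Arguments.
Unset Strict Implicit.
Unset Printing Implicit Defensive.
Import Order.TTheory GRing.Theory Num.Theory.
Local Open Scope classical_set_scope.
Local Open Scope ring_scope.

Section ConvexAnalysis.
Variable R : realType.

(* Convexity, on a set [D], of a function with values in R U {+oo}.  [convex_function]
   of mathcomp.analysis.convex only covers real-valued functions. *)
Definition convex_on (V : lmodType R) (D : set V) (h : V -> \bar R) : Prop :=
  (forall u, D u -> h u != -oo%E) /\
  (forall (u v : V) (t : R), D u -> D v -> 0 < t < 1 ->
    (h (t *: u + (1 - t) *: v)%R <= t%:E * h u + (1 - t)%:E * h v)%E).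

Definition concave_on (V : lmodType R) (D : set V) (h : V -> \bar R) : Prop :=
  convex_on D (fun u => - h u)%E.

Definition posemidef (m : nat) (A : 'M[R]_m) : Prop :=
  A \is symmetricmx /\ forall u : 'cV[R]_m, 0 <= (u^T *m A *m u) ord0 ord0.

Variables E Es : vectType R.

(* [Es] plays the role of the dual of [E]: a nondegenerate pairing identifies it
   with the space of linear forms on [E]. *)
Definition nondegenerate_pairing (pairing : Es -> E -> R) : Prop :=
  (forall s, (forall x, pairing s x = 0) -> s = 0) /\
  (forall x, (forall s, pairing s x = 0) -> x = 0).

Definition self_adjoint (pairing : Es -> E -> R) (B : 'Hom(E, Es)) : Prop :=
  forall x y, pairing (B x) y = pairing (B y) x.

Definition positive_definite (pairing : Es -> E -> R) (B : 'Hom(E, Es)) : Prop :=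
  forall x, x != 0 -> 0 < pairing (B x) x.

(* [B^-1] is the library's right inverse of [B] on its range; it is the genuine
   inverse as soon as [B] is positive definite for a nondegenerate pairing. *)
Definition dual_dot (pairing : Es -> E -> R) (B : 'Hom(E, Es)) (s t : Es) : R :=
  pairing s (B^-1%VF t).

Definition subdifferential (pairing : Es -> E -> R) (F : E -> \bar R) (x : E) : set Es :=
  [set g | F x \is a fin_num /\
           forall y, (F x + (pairing g (y - x)%R)%:E <= F y)%E].

End ConvexAnalysis.

Section PEP.
Variables (R : realType) (E Es : vectType R).
Variables (pairing : Es -> E -> R) (B : 'Hom(E, Es)).
Variables (n N : nat).

(* The index set {0, ..., N, *} is encoded as 'I_N.+2, the index * being the last one,
   [ord_max]; the components k = 1, ..., n are indexed by 'I_n. *)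
Record pep_point := Point {
  pt_x : 'I_N.+2 -> E;
  pt_f : 'I_N.+2 -> 'I_n -> R;
  pt_g : 'I_N.+2 -> 'I_n -> Es }.

Definition interpolable (C : set (E -> \bar R))
    (x : 'I_N.+2 -> E) (g : 'I_N.+2 -> Es) (f : 'I_N.+2 -> R) : Prop :=
  exists2 F, C F & forall i, F (x i) = (f i)%:E /\ subdifferential pairing F (x i) (g i).

(* [EQ i] is the equation (EQ_i): it only sees x_0, ..., x_i and the oracle outputs at
   these points.  Only 1 <= i <= N is relevant. *)
Definition method_equations : Type :=
  forall i : nat, ('I_i.+1 -> E) -> ('I_i.+1 -> 'I_n -> R) ->
    ('I_i.+1 -> 'I_n -> Es) -> Prop.

(* The arguments are x_0, x_*, and the oracle outputs f and g. *)
Definition initial_condition : Type :=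
  E -> E -> ('I_N.+2 -> 'I_n -> R) -> ('I_N.+2 -> 'I_n -> Es) -> Prop.

Definition performance_measure : Type := pep_point -> R.

Variables (Fc : 'I_n -> set (E -> \bar R)) (EQ : method_equations).
Variables (Init : initial_condition) (Perf : performance_measure).

Definition class_condition (k : 'I_n) (p : pep_point) : Prop :=
  interpolable (Fc k) (pt_x p) (fun i => pt_g p i k) (fun i => pt_f p i k).

Definition method_condition (p : pep_point) : Prop :=
  forall i : nat, (1 <= i <= N)%N ->
    @EQ i (fun j => pt_x p (inord j)) (fun j => pt_f p (inord j))
          (fun j => pt_g p (inord j)).

Definition init_condition (p : pep_point) : Prop :=
  Init (pt_x p ord0) (pt_x p ord_max) (pt_f p) (pt_g p).

Definition star_optimal (p : pep_point) : Prop := \sum_(k < n) pt_g p ord_max k = 0.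

Definition pep_feasible : set pep_point :=
  [set p | [/\ forall k, class_condition k p, init_condition p,
               method_condition p & star_optimal p]].

Definition worst_case_value : \bar R :=
  ereal_sup [set (Perf p)%:E | p in pep_feasible].

Definition P_list (p : pep_point) : seq Es :=
  [seq B (pt_x p i) | i <- enum 'I_N.+2] ++
  [seq pt_g p i k | i <- enum 'I_N.+2, k <- enum 'I_n].

Definition F_list (p : pep_point) : seq R :=
  [seq pt_f p i k | i <- enum 'I_N.+2, k <- enum 'I_n].

Definition F_vec (p : pep_point) : 'cV[R]_(n * N.+2) := \col_i (F_list p)`_i.

Definition Gram_mx (p : pep_point) : 'M[R]_(n.+1 * N.+2) :=
  \matrix_(i, j) dual_dot pairing B (P_list p)`_i (P_list p)`_j.

Definition FG : lmodType R := ('cV[R]_(n * N.+2) * 'M[R]_(n.+1 * N.+2))%type.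

Definition gram_repr (p : pep_point) : FG := (F_vec p, Gram_mx p).

(* The space R^(n(N+2)) x S^((n+1)(N+2)): functions of (F, G) only matter there. *)
Definition sym_domain : set FG := [set v | v.2 \is symmetricmx].

(* A function [h] stands for the constraint h(F, G) <= 0. *)
Definition satisfies (cs : seq (FG -> \bar R)) (v : FG) : Prop :=
  all (fun h => (h v <= 0)%E) cs.

Definition affine_constraint (h : FG -> \bar R) : Prop :=
  exists (a : R) (b : 'cV[R]_(n * N.+2)) (D : 'M[R]_(n.+1 * N.+2)),
    D \is symmetricmx /\
    forall v, sym_domain v -> h v = (a + (b^T *m v.1) ord0 ord0 + \tr (D *m v.2))%:E.

Definition linear_objective (h : FG -> \bar R) : Prop :=
  exists (c : 'cV[R]_(n * N.+2)) (C : 'M[R]_(n.+1 * N.+2)),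
    C \is symmetricmx /\
    forall v, sym_domain v -> h v = ((c^T *m v.1) ord0 ord0 + \tr (C *m v.2))%:E.

Definition gram_represents (A : pep_point -> Prop) (cs : seq (FG -> \bar R)) : Prop :=
  List.Forall (convex_on sym_domain) cs /\
  forall p, A p <-> satisfies cs (gram_repr p).

Definition linearly_gram_represents (A : pep_point -> Prop) (cs : seq (FG -> \bar R)) : Prop :=
  List.Forall affine_constraint cs /\
  forall p, A p <-> satisfies cs (gram_repr p).

Definition gram_represents_measure (obj : FG -> \bar R) : Prop :=
  concave_on sym_domain obj /\ forall p, obj (gram_repr p) = (Perf p)%:E.

Definition linearly_gram_represents_measure (obj : FG -> \bar R) : Prop :=
  linear_objective obj /\ forall p, obj (gram_repr p) = (Perf p)%:E.

(* The last n entries of [P_list] are g_*^(1), ..., g_*^(n), so this is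
   < sum_k g_*^(k), sum_k g_*^(k) > read off the Gram matrix. *)
Definition star_sqnorm (v : FG) : \bar R :=
  (\sum_(i | (N.+2 + N.+1 * n <= val i)%N)
     \sum_(j | (N.+2 + N.+1 * n <= val j)%N) v.2 i j)%:E.

(* The equality constraint star_sqnorm = 0, as two inequalities. *)
Definition optimality_constraints : seq (FG -> \bar R) :=
  [:: star_sqnorm; fun v => (- star_sqnorm v)%E].

(* The program: maximize [gp_obj] subject to h <= 0 for h in [gp_cons], and G psd. *)
Record gram_program := GramProgram {
  gp_obj : FG -> \bar R;
  gp_cons : seq (FG -> \bar R) }.

Definition convex_program (Q : gram_program) : Prop :=
  concave_on sym_domain (gp_obj Q) /\ List.Forall (convex_on sym_domain) (gp_cons Q).

Definition gp_feasible (Q : gram_program) : set FG :=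
  [set v | satisfies (gp_cons Q) v /\ posemidef v.2].

Definition rank_at_most (d : nat) : set FG := [set v | (\rank v.2 <= d)%N].

Definition pep_program (cF : 'I_n -> seq (FG -> \bar R)) (cM cI : seq (FG -> \bar R))
    (obj : FG -> \bar R) : gram_program :=
  GramProgram obj
    (flatten [seq cF k | k <- enum 'I_n] ++ cM ++ cI ++ optimality_constraints).

(* Maximizing [obj] over [S] is a formulation of the performance estimation problem. *)
Definition formulates (obj : FG -> \bar R) (S : set FG) : Prop :=
  [/\ S = [set gram_repr p | p in pep_feasible],
      forall p, pep_feasible p -> obj (gram_repr p) = (Perf p)%:E
    & worst_case_value = ereal_sup [set obj v | v in S]].

Definition sdp_objective (c : 'cV[R]_(n * N.+2)) (C : 'M[R]_(n.+1 * N.+2))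
    (v : FG) : \bar R :=
  ((c^T *m v.1) ord0 ord0 + \tr (C *m v.2))%:E.

Definition sdp_feasible (S : finType) (a : S -> R) (b : S -> 'cV[R]_(n * N.+2))
    (D : S -> 'M[R]_(n.+1 * N.+2)) : set FG :=
  [set v | (forall i, a i + ((b i)^T *m v.1) ord0 ord0 + \tr (D i *m v.2) <= 0) /\
           posemidef v.2].

End PEP.

(* Main.v *)
(* The pair (F_N, G_N) of a point of (PEP) determines whether the point is feasible,
   so everything reduces to describing the Gram matrices of families of m vectors of
   a Euclidean space of dimension d: they are the positive semidefinite matrices of
   rank at most d.  If such a matrix is [M M^T] with d columns in [M], and the Gram
   matrix of a basis of [E] is [K K^T], the vectors whose coordinates in this basis
   are the rows of [M K^-1] realize it.  Nondegeneracy of the pairing makes [B]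
   surjective, so that all of E^* is reached from E. *)
Require Import Defs.
From HB Require Import structures.
From mathcomp Require Import all_boot all_order all_algebra.
From mathcomp Require Import boolp classical_sets reals ereal.
From mathcomp Require Import ring.

Set Implicit Arguments.
Unset Strict Implicit.
Unset Printing Implicit Defensive.
Import Order.TTheory GRing.Theory Num.Theory.
Local Open Scope classical_set_scope.
Local Open Scope ring_scope.

(** * Positive semidefinite matrices and their factorization *)

Section PositiveSemidefinite.
Variable R : realType.

Lemma symmetricmxP (m : nat) (A : 'M[R]_m) :
  reflect (A^T = A) (A \is symmetricmx).
Proof.
by apply: (iffP (is_hermitianmxP _ _ _)); rewrite scale1r map_mx_id // => ->.
Qed.

Lemma posemidef_congr (m k : nat) (A : 'M[R]_m) (Q : 'M[R]_(m, k)) :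
  posemidef A -> posemidef (Q^T *m A *m Q).
Proof.
case=> /symmetricmxP Asym Age0; split.
  by apply/symmetricmxP; rewrite !trmx_mul trmxK Asym mulmxA.
by move=> u; have := Age0 (Q *m u); rewrite trmx_mul !mulmxA.
Qed.

Lemma posemidef_diag_ge0 (m : nat) (A : 'M[R]_m) i : posemidef A -> 0 <= A i i.
Proof.
by case=> _ /(_ (delta_mx i 0)); rewrite trmx_delta -rowE -colE !mxE.
Qed.

(** With a zero diagonal, the quadratic form at [e_j - A i j e_i] equals [-2 (A i j)^2], so its
    nonnegativity forces each entry to vanish. *)
Lemma posemidef_diag0 (m : nat) (A : 'M[R]_m) :
  posemidef A -> (forall i, A i i = 0) -> A = 0.
Proof.
case=> /symmetricmxP Asym Age0 A0; apply/matrixP => i j; rewrite mxE.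
have Aji : A j i = A i j by rewrite -{1}Asym mxE.
have e k l : delta_mx 0 k *m A *m delta_mx l 0 = (A k l)%:M :> 'M_1.
  by rewrite [LHS]mx11_scalar -rowE -colE !mxE.
have := Age0 (delta_mx j 0 - A i j *: delta_mx i 0).
rewrite [(_ - _)^T]linearB /= [(_ *: _)^T]linearZ /= !trmx_delta !(mulmxBl, mulmxBr).
rewrite -!(scalemxAl, scalemxAr).
rewrite !e !A0 Aji !mxE !mulr1n !mulr0 subr0 sub0r.
rewrite addrC -opprD oppr_ge0 -mulr2n pmulrn_lle0 // => Aij2.
by apply/eqP; rewrite -sqrf_eq0 eq_le sqr_ge0 expr2 Aij2.
Qed.

(* One step of Gaussian elimination on a nonzero diagonal entry [A i i] splits off
   a rank-one term and leaves a congruent, hence positive semidefinite, matrix. *)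
Lemma posemidef_factor (m r : nat) (A : 'M[R]_m) :
  posemidef A -> (\rank A <= r)%N -> exists M : 'M[R]_(m, r), A = M *m M^T.
Proof.
elim: r => [|r IHr] in A *.
  move=> _; rewrite leqn0 mxrank_eq0 => /eqP ->.
  by exists 0; rewrite mul0mx.
move=> Apsd rA; have [/forallP A0|] := boolP [forall i, A i i == 0].
  exists 0; rewrite mul0mx; apply: posemidef_diag0 => // i.
  exact/eqP.
rewrite negb_forall => /existsP[i Aii0].
have Asym : A^T = A by apply/symmetricmxP; case: Apsd.
have Aii_gt0 : 0 < A i i by rewrite lt_def Aii0 posemidef_diag_ge0.
have rowc : row i A = (col i A)^T by rewrite tr_col Asym.
pose S := (A i i)^-1 *: (col i A *m row i A).
have A'psd : posemidef (A - S).
  (* [Q] is the elimination matrix: [Q^T A] is already [A - S], whose column [i] is zero, so the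
     right factor [Q] changes nothing more. *)
  pose Q : 'M_m := 1%:M - (A i i)^-1 *: (delta_mx i 0 *m row i A).
  suff -> : A - S = Q^T *m A *m Q by apply: posemidef_congr.
  have QA : Q^T *m A = A - S.
    rewrite /Q [(_ - _)^T]linearB /= [(_ *: _)^T]linearZ /= trmx1 trmx_mul trmx_delta rowc trmxK.
    by rewrite mulmxBl mul1mx -scalemxAl -mulmxA -rowE.
  rewrite QA /Q mulmxBr mulmx1 -scalemxAr mulmxA -colE.
  suff -> : col i (A - S) = 0 by rewrite mul0mx scaler0 subr0.
  apply/colP => j; rewrite !mxE big_ord1 !mxE.
  by rewrite mulrCA mulVf // mulr1 subrr.
have rA' : (\rank (A - S)%R <= r)%N.
  rewrite -ltnS; apply: leq_trans _ rA.
  (* The rank drops because the left kernel grows strictly: [e_i] kills [A - S] but not [A], since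
     [A i i] is nonzero. *)
  have : (kermx A < kermx (A - S)%R)%MS.
    rewrite ltmxE; apply/andP; split.
      apply/sub_kermxP; rewrite mulmxBr mulmx_ker sub0r.
      by rewrite -scalemxAr mulmxA colE (mulmxA _ A) mulmx_ker mul0mx mul0mx scaler0 oppr0.
    apply/negP => sub.
    have : ((delta_mx 0 i : 'rV_m) <= kermx (A - S)%R)%MS.
      apply/sub_kermxP; rewrite -rowE; apply/rowP => j.
      rewrite !mxE big_ord1 !mxE.
      by rewrite mulrA mulVf // mul1r subrr.
    move/submx_trans => /(_ _ _ sub) /sub_kermxP; rewrite -rowE => /rowP/(_ i).
    by rewrite !mxE => /eqP; rewrite (negPf Aii0).
  move/rank_ltmx; rewrite !mxrank_ker.
  have := rank_leq_row A; have := rank_leq_row (A - S)%R.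
  by move=> h1 h2; rewrite ltn_sub2lE.
have [M AM] := IHr _ A'psd rA'.
(* Scaled so that [c c^T] is the rank-one term [S]; it becomes the extra column in front of [M]. *)
pose c := (Num.sqrt (A i i))^-1 *: col i A.
exists (row_mx c M); apply/esym/(etrans (y := c *m c^T + M *m M^T)).
  by rewrite -mul_row_col -tr_row_mx.
rewrite -AM /c [(_ *: _)^T]linearZ /= -scalemxAl -scalemxAr scalerA.
by rewrite -expr2 exprVn sqr_sqrtr ?ltW // -rowc addrC subrK.
Qed.

End PositiveSemidefinite.

(** * Gram matrices of families of vectors in a Euclidean space *)

Section GramMatrices.
Variables (R : realType) (E Es : vectType R).
Variable pairing : {bilinear Es -> E -> R | *%R & *%R}.
Variable B : 'Hom(E, Es).
Hypothesis B_sa : self_adjoint pairing B.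
Hypothesis B_pd : positive_definite pairing B.

Definition gram (m : nat) (y : 'I_m -> E) : 'M[R]_m :=
  \matrix_(i, j) pairing (B (y i)) (y j).

Definition combination (k m : nat) (y : 'I_k -> E) (W : 'M[R]_(m, k)) (i : 'I_m) : E :=
  \sum_j W i j *: y j.

Lemma gram_combination (k m : nat) (y : 'I_k -> E) (W : 'M[R]_(m, k)) :
  gram (combination y W) = W *m gram y *m W^T.
Proof.
apply/matrixP => i j; rewrite !mxE /combination linear_sumr.
apply: eq_bigr => l _; rewrite !mxE linearZr_LR [B _]linear_sum /=.
rewrite linear_sumlz mulrC; congr (_ * _); apply: eq_bigr => l' _.
by rewrite !mxE linearZ /= linearZl_LR.
Qed.

Lemma pairing_ge0 y : 0 <= pairing (B y) y.
Proof.
have [->|/B_pd/ltW //] := eqVneq y 0.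
by rewrite linear0r.
Qed.

Lemma gram_psd (m : nat) (y : 'I_m -> E) : posemidef (gram y).
Proof.
split; first by apply/symmetricmxP/matrixP => i j; rewrite !mxE B_sa.
(* With [u^T] as a one-row coefficient matrix, [u^T G u] is the squared norm of the single vector
   with coefficients [u]. *)
move=> u; rewrite -[u in X in _ *m X]trmxK -gram_combination mxE.
exact: pairing_ge0.
Qed.

Lemma combination_basis (m : nat) (y : 'I_m -> E) :
  exists W, y = combination (fun j : 'I_(\dim {:E}) => (vbasis {:E})`_j) W.
Proof.
exists (\matrix_(i, j) coord (vbasis {:E}) j (y i)).
apply/funext => i; rewrite [LHS](coord_vbasis (memvf _)).
by apply: eq_bigr => j _; rewrite mxE.
Qed.

Lemma gram_rank (m : nat) (y : 'I_m -> E) : (\rank (gram y) <= \dim {:E})%N.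
Proof.
have [W ->] := combination_basis y.
by rewrite gram_combination -mulmxA mulmx_max_rank.
Qed.

(** A left kernel vector [u] gives a combination [z] of the basis with [<B z, z> = 0]; definiteness
    makes [z] zero, and freeness makes [u] zero. *)
Lemma gram_basis_unit : gram (fun j : 'I_(\dim {:E}) => (vbasis {:E})`_j) \in unitmx.
Proof.
rewrite -row_free_unit -kermx_eq0; apply/rowV0P => u /sub_kermxP uG0.
pose z := combination (fun j : 'I_(\dim {:E}) => (vbasis {:E})`_j) u ord0.
have z0 : z = 0.
  apply/eqP; apply: contraT => /B_pd.
  suff -> : pairing (B z) z = 0 by rewrite ltxx.
  have -> : pairing (B z) z = gram (combination
      (fun j : 'I_(\dim {:E}) => (vbasis {:E})`_j) u) ord0 ord0 by rewrite mxE.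
  by rewrite gram_combination uG0 mul0mx mxE.
have /freeP/(_ (u ord0)) u0 := basis_free (vbasisP {:E}).
by apply/rowP => j; rewrite mxE u0.
Qed.

Lemma gram_realizable (m : nat) (G : 'M[R]_m) :
  posemidef G -> (\rank G <= \dim {:E})%N -> exists y, gram y = G.
Proof.
move=> Gpsd /(posemidef_factor Gpsd)[M ->].
pose e := fun j : 'I_(\dim {:E}) => (vbasis {:E})`_j.
(* The number of rows serves as the rank bound, so [K] is square; it is invertible because [K K^T]
   is. *)
have [K eK] := posemidef_factor (gram_psd e) (rank_leq_row _).
have := gram_basis_unit; rewrite -/e eK unitmx_mul => /andP[Ku _].
exists (combination e (M *m invmx K)).
by rewrite gram_combination eK mulmxA mulmxKV // -mulmxA -trmx_mul mulmxKV.
Qed.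

Lemma pd_lker : lker B == 0%VS.
Proof.
apply/lker0P => x y Bxy; apply/eqP; rewrite -subr_eq0.
apply: contraT => /B_pd.
by rewrite [B _]linearB /= Bxy subrr linear0l ltxx.
Qed.

Lemma pd_lfunK : cancel B (B^-1)%VF.
Proof. exact: lker0_lfunK pd_lker. Qed.

Hypothesis pairing_nd : nondegenerate_pairing pairing.

(** The matrix of the pairing in bases has independent rows: a relation between them is a functional
    vanishing on all of [E], hence zero. This inequality turns the injectivity of [B] into
    surjectivity. *)
Lemma pairing_dim : (\dim {:Es} <= \dim {:E})%N.
Proof.
pose bs := vbasis {:Es}; pose b := vbasis {:E}.
pose A : 'M_(_, _) := \matrix_(i < \dim {:Es}, j < \dim {:E}) pairing bs`_i b`_j.
suff : row_free A by rewrite /row_free => /eqP <-; exact: rank_leq_col.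
rewrite -kermx_eq0; apply/rowV0P => u /sub_kermxP uA0.
have /freeP/(_ (u ord0)) u0 := basis_free (vbasisP {:Es}).
apply/rowP => j; rewrite mxE u0 //.
apply: (proj1 pairing_nd) => x.
rewrite (coord_vbasis (memvf x)) linear_sumr big1 // => l _.
rewrite linearZr_LR /= linear_sumlz.
have /rowP/(_ l) := uA0; rewrite !mxE => uAl.
rewrite (eq_bigr (fun i => u 0 i * A i l)) ?uAl ?mulr0 // => i _.
by rewrite linearZl_LR /= mxE.
Qed.

Lemma pd_lfunVK : cancel (B^-1)%VF B.
Proof.
move=> s; apply: limg_lfunVK.
suff -> : limg B = fullv by rewrite memvf.
apply/eqP; rewrite eqEdim subvf /= limg_dim_eq; first exact: pairing_dim.
by rewrite (eqP pd_lker) capv0.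
Qed.

End GramMatrices.

(** * Convexity and affine form of the constraints *)

Section ConvexConstraints.
Variables (R : realType) (n N : nat).
Implicit Types (h : FG R n N -> \bar R) (cs : seq (FG R n N -> \bar R)).

Lemma affine_constraint_convex h : affine_constraint h -> convex_on (@sym_domain R n N) h.
Proof.
move=> [a [b [D [_ hE]]]]; split=> [u su|u w t su sw _]; first by rewrite hE.
have su' : u.2^T = u.2 by apply/symmetricmxP.
have sw' : w.2^T = w.2 by apply/symmetricmxP.
rewrite !hE //.
- rewrite -!EFinM -EFinD lee_fin /= !mulmxDr -!scalemxAr.
  rewrite mxtraceD !mxtraceZ [X in a + X]mxE [X in a + (X + _)]mxE [X in a + (_ + X)]mxE.
  (* An affine function meets the convexity inequality with equality. *)
  by rewrite le_eqVlt; apply/orP; left; apply/eqP; ring.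
- apply/symmetricmxP => /=.
  by rewrite [(_ + _)^T]linearD /= ![(_ *: _)^T]linearZ /= su' sw'.
Qed.

Lemma linear_objective_affine h : linear_objective h -> affine_constraint h.
Proof.
move=> [c [C [Csym hE]]]; exists 0, c, C; split=> // v /hE ->.
by rewrite add0r.
Qed.

Lemma linear_objective_opp_affine h :
  linear_objective h -> affine_constraint (fun v => - h v)%E.
Proof.
move=> [c [C [Csym hE]]]; exists 0, (- c), (- C); split=> [|v /hE ->].
  by apply/symmetricmxP; rewrite linearN /= (symmetricmxP _ Csym).
by rewrite add0r [(- c)^T]linearN /= !mulNmx [\tr (- _)]linearN /= [X in X - _]mxE -opprD.
Qed.

Lemma star_sqnorm_linear : linear_objective (@star_sqnorm R n N).
Proof.
pose star i := (N.+2 + N.+1 * n <= i)%N.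
(* The matrix is the 0/1 indicator of the block indexed by the [g_*] entries, so the trace sums
   exactly that block. *)
exists 0, (\matrix_(i, j) (star i && star j)%:R); split.
  by apply/symmetricmxP/matrixP => i j; rewrite !mxE andbC.
move=> v _; rewrite trmx0 mul0mx mxE add0r; congr (_%:E).
rewrite /mxtrace exchange_big /= big_mkcond /=; apply: eq_bigr => j _.
rewrite mxE; case: ifP => [sj|sj].
  rewrite big_mkcond /=; apply: eq_bigr => i _; rewrite mxE [star j]sj /=.
  by rewrite /star; case: ifP => _; rewrite ?mul1r ?mul0r.
by rewrite big1 // => i _; rewrite mxE [star j]sj mul0r.
Qed.

Lemma optimality_constraints_affine :
  List.Forall (@affine_constraint R n N) (@optimality_constraints R n N).
Proof.
have lin := star_sqnorm_linear.
repeat constructor; first exact: linear_objective_affine.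
exact: linear_objective_opp_affine.
Qed.

Lemma Forall_flatten (T I : Type) (P : T -> Prop) (f : I -> seq T) (s : seq I) :
  (forall i, List.Forall P (f i)) -> List.Forall P (flatten [seq f i | i <- s]).
Proof.
by move=> Pf; elim: s => [|i s IH] /=; [constructor | apply/List.Forall_app].
Qed.

Lemma Forall_gp_cons P (cF : 'I_n -> seq (FG R n N -> \bar R)) cM cI obj :
  (forall k, List.Forall P (cF k)) -> List.Forall P cM -> List.Forall P cI ->
  List.Forall P (@optimality_constraints R n N) ->
  List.Forall P (gp_cons (pep_program cF cM cI obj)).
Proof.
move=> PF PM PI PO /=; apply/List.Forall_app; split; first exact: Forall_flatten.
by do 2 (apply/List.Forall_app; split=> //).
Qed.

(** The index set consists of the positions in the list, and choice selects coefficients for each.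
    The function [h0] is only a default for [nth], never reached. *)
Lemma satisfies_affine cs : List.Forall (@affine_constraint R n N) cs ->
  exists (S : finType) (a : S -> R) (b : S -> 'cV[R]_(n * N.+2))
         (D : S -> 'M[R]_(n.+1 * N.+2)),
    (forall i, D i \is symmetricmx) /\
    forall v, sym_domain v -> satisfies cs v <->
      forall i, a i + ((b i)^T *m v.1) ord0 ord0 + \tr (D i *m v.2) <= 0.
Proof.
pose h0 : FG R n N -> \bar R := fun=> 0%E.
move=> csA.
have nthA (i : 'I_(size cs)) : affine_constraint (nth h0 cs i).
  case: i => i /= si; elim: csA i si => // h s hA _ IH [|i] //=.
  exact: IH.
have /choice[abD abDE] : forall i : 'I_(size cs), exists abD :
    R * 'cV[R]_(n * N.+2) * 'M[R]_(n.+1 * N.+2),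
    abD.2 \is symmetricmx /\ forall v, sym_domain v ->
      nth h0 cs i v = (abD.1.1 + (abD.1.2^T *m v.1) ord0 ord0 + \tr (abD.2 *m v.2))%:E.
  by move=> i; have [a [b [D ?]]] := nthA i; exists (a, b, D).
exists 'I_(size cs), (fun i => (abD i).1.1), (fun i => (abD i).1.2), (fun i => (abD i).2).
split=> [i|v sv]; first by case: (abDE i).
split=> [/(all_nthP h0) cv i|cv].
  by have := cv i (ltn_ord i); rewrite (proj2 (abDE i)) // lee_fin.
apply/(all_nthP h0) => i si.
by have := cv (Ordinal si); rewrite -lee_fin -(proj2 (abDE _)).
Qed.

End ConvexConstraints.

(** As [L] has no repetition, looking up the position of [t] in [L] defines a function whose list of
    values is [s]. Points with prescribed [P_list] and [F_list] are built this way. *)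
Lemma map_surj (T : eqType) (V : Type) (x0 : V) (L : seq T) (s : seq V) :
  uniq L -> size s = size L -> map (fun t => nth x0 s (index t L)) L = s.
Proof.
move=> uL sL; apply: (@eq_from_nth _ x0); rewrite size_map // => i si.
have [t0] : exists t0 : T, true by case: L si {uL sL} => // t; exists t.
by move=> _; rewrite (nth_map t0) // index_uniq.
Qed.

Lemma all_flatten_map (T I : Type) (a : pred T) (f : I -> seq T) (s : seq I) :
  all a (flatten [seq f i | i <- s]) = all (fun i => all a (f i)) s.
Proof. by elim: s => //= i s IHs; rewrite all_cat IHs. Qed.

(** * Points of the performance estimation problem and their Gram pairs *)

Section GramProgram.
Variables (R : realType) (E Es : vectType R).
Variable pairing : {bilinear Es -> E -> R | *%R & *%R}.
Hypothesis pairing_nd : nondegenerate_pairing pairing.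
Variable B : 'Hom(E, Es).
Hypothesis B_sa : self_adjoint pairing B.
Hypothesis B_pd : positive_definite pairing B.
Variables n N : nat.
Implicit Type p : pep_point E Es n N.

(** Surjectivity of [B] pulls the dual vectors back to [E], so that [gram_psd] and [gram_rank] apply
    to the matrix of a point. *)
Lemma Gram_mxE p :
  Gram_mx pairing B p = gram pairing B (fun i => (B^-1)%VF (P_list B p)`_i).
Proof.
by apply/matrixP => i j; rewrite !mxE (pd_lfunVK B_pd pairing_nd).
Qed.

(** Any [s] is [B z], and [<B z, z>] is positive unless [z = 0]. Hence the scalar optimality
    constraint is equivalent to the vector one. *)
Lemma dual_dot_eq0 s : (dual_dot pairing B s s == 0) = (s == 0).
Proof.
rewrite /dual_dot -{1}(pd_lfunVK B_pd pairing_nd s).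
have [-> |s0] := eqVneq s 0; first by rewrite !linear0 eqxx.
suff /B_pd/lt0r_neq0/negPf -> : (B^-1)%VF s != 0 by [].
apply: contraNneq s0 => Bs0; apply/eqP.
by rewrite -(pd_lfunVK B_pd pairing_nd s) Bs0 linear0.
Qed.

(** The common order of the entries of [F_list] and of the gradients in [P_list]. *)
Let pairs : seq ('I_N.+2 * 'I_n) := [seq (i, k) | i <- enum 'I_N.+2, k <- enum 'I_n].

Lemma pairs_uniq : uniq pairs.
Proof. by apply: allpairs_uniq; rewrite ?enum_uniq // => -[? ?] [? ?]. Qed.

Lemma size_pairs : size pairs = (n * N.+2)%N.
Proof. by rewrite size_allpairs !size_enum_ord mulnC. Qed.

Lemma size_P_list p : size (P_list B p) = (n.+1 * N.+2)%N.
Proof. by rewrite size_cat size_map size_allpairs !size_enum_ord [RHS]mulSn (mulnC n). Qed.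

(** The index [*] comes last in the enumeration: before its gradients stand [N.+2] images of
    iterates and [N.+1 * n] other gradients. *)
Lemma drop_P_list p :
  drop (N.+2 + N.+1 * n) (P_list B p) = [seq pt_g p ord_max k | k <- enum 'I_n].
Proof.
rewrite /P_list {2}enum_ordSr allpairs_rcons catA drop_size_cat //.
by rewrite size_cat size_map size_allpairs size_map !size_enum_ord.
Qed.

Lemma star_sum p :
  \sum_(i < n.+1 * N.+2 | (N.+2 + N.+1 * n <= i)%N) (P_list B p)`_i =
  \sum_(k < n) pt_g p ord_max k.
Proof.
rewrite -(big_geq_mkord _ (n.+1 * N.+2) xpredT (fun i => (P_list B p)`_i)).
rewrite -[X in \big[_/_]_(X <= _ < _) _]add0n big_addn.
transitivity (\sum_(s <- [seq pt_g p ord_max k | k <- enum 'I_n]) s).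
  rewrite -drop_P_list [RHS](big_nth 0) size_drop size_P_list.
  by apply: eq_bigr => i _; rewrite nth_drop addnC.
by rewrite big_map big_enum.
Qed.

Lemma star_sqnorm_gram p : star_sqnorm (gram_repr pairing B p) =
  (dual_dot pairing B (\sum_(k < n) pt_g p ord_max k) (\sum_(k < n) pt_g p ord_max k))%:E.
Proof.
congr (_%:E); rewrite -star_sum /dual_dot linear_sumlz.
apply: eq_bigr => i _; rewrite linear_sum linear_sumr.
by apply: eq_bigr => j _; rewrite mxE.
Qed.

Lemma star_optimalE p :
  star_optimal p <-> satisfies (@optimality_constraints R n N) (gram_repr pairing B p).
Proof.
pose v := gram_repr pairing B p.
have -> : satisfies (@optimality_constraints R n N) v =
    ((star_sqnorm v <= 0)%E && (- star_sqnorm v <= 0)%E) :> Prop.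
  by congr is_true; rewrite -[X in _ && X]andbT.
rewrite star_sqnorm_gram -EFinN !lee_fin oppr_le0 -eq_le.
by rewrite dual_dot_eq0; split=> /eqP.
Qed.

Lemma gram_repr_psd p : posemidef (gram_repr pairing B p).2.
Proof. by rewrite /= Gram_mxE; exact: gram_psd. Qed.

Lemma gram_repr_rank p : rank_at_most (\dim {:E}) (gram_repr pairing B p).
Proof. by rewrite /rank_at_most /= Gram_mxE; exact: gram_rank. Qed.

(** The point need not be feasible: the first [N.+2] vectors realizing [G] become the [x] entries,
    the images under [B] of the others the [g] entries, and [F] supplies the values. *)
Lemma gram_repr_surj (v : FG R n N) :
  posemidef v.2 -> rank_at_most (\dim {:E}) v -> exists p, gram_repr pairing B p = v.
Proof.
case: v => F G /= Gpsd Grk; have [y yG] := gram_realizable B_sa B_pd Gpsd Grk.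
pose s := [seq y i | i <- enum 'I_(n.+1 * N.+2)].
pose sF := [seq F i 0 | i <- enum 'I_(n * N.+2)].
pose x (i : 'I_N.+2) := nth 0 (take N.+2 s) (index i (enum 'I_N.+2)).
pose f ik := nth 0 sF (index ik pairs).
pose g ik := nth 0 (map B (drop N.+2 s)) (index ik pairs).
pose p := Point x (fun i k => f (i, k)) (fun i k => g (i, k)).
have ss : size s = (N.+2 + n * N.+2)%N by rewrite size_map size_enum_ord.
have FE : F_list p = sF.
  rewrite -[RHS](@map_surj _ _ 0 pairs) ?pairs_uniq //; last first.
    by rewrite size_pairs size_map size_enum_ord.
  by rewrite map_allpairs.
have PE : P_list B p = map B s.
  rewrite -(cat_take_drop N.+2 s) map_cat; congr (_ ++ _).
    rewrite -[in RHS](@map_surj _ _ 0 (enum 'I_N.+2) (take N.+2 s)) -?map_comp //.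
      exact: enum_uniq.
    by rewrite size_enum_ord size_takel // ss leq_addr.
  rewrite -[RHS](@map_surj _ _ 0 pairs) ?pairs_uniq ?map_allpairs //.
  by rewrite size_map size_drop ss addKn size_pairs.
exists p; congr (_, _).
  apply/colP => i; rewrite mxE FE (nth_map i) ?size_enum_ord // nth_ord_enum.
  by congr (F _ _); exact: val_inj.
have nthP (k : 'I_(n.+1 * N.+2)) : (P_list B p)`_k = B (y k).
  by rewrite PE /s -map_comp (nth_map k) ?size_enum_ord // nth_ord_enum.
by rewrite -yG; apply/matrixP => i j; rewrite !mxE !nthP /dual_dot (pd_lfunK B_pd).
Qed.

Variables (Fc : 'I_n -> set (E -> \bar R)) (EQ : method_equations E Es n).
Variables (Init : initial_condition E Es n N) (Perf : performance_measure E Es n N).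

Lemma gp_cons_feasible (cF : 'I_n -> seq (FG R n N -> \bar R)) cM cI obj :
  (forall k p, class_condition pairing Fc k p <-> satisfies (cF k) (gram_repr pairing B p)) ->
  (forall p, method_condition EQ p <-> satisfies cM (gram_repr pairing B p)) ->
  (forall p, init_condition Init p <-> satisfies cI (gram_repr pairing B p)) ->
  forall p, satisfies (gp_cons (pep_program cF cM cI obj)) (gram_repr pairing B p) <->
    pep_feasible pairing Fc EQ Init p.
Proof.
move=> cFE cME cIE p; rewrite /satisfies /= !all_cat all_flatten_map.
split=> [/and4P[/allP hF hM hI hO]|[hF hI hM hO]].
  split; [|exact/cIE|exact/cME|exact/star_optimalE].
  by move=> k; apply/cFE/hF; rewrite mem_enum.
apply/and4P; split; [|exact/cME|exact/cIE|exact/star_optimalE].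
by apply/allP => k _; apply/cFE.
Qed.

(** Membership in [A] is read off the pair alone, so any preimage supplied by [gram_repr_surj] will
    do. *)
Lemma gp_feasible_image (cs : seq (FG R n N -> \bar R)) obj (A : set (pep_point E Es n N)) :
  (forall p, satisfies cs (gram_repr pairing B p) <-> A p) ->
  gp_feasible (GramProgram obj cs) `&` rank_at_most (\dim {:E}) =
    [set gram_repr pairing B p | p in A].
Proof.
move=> csA; apply/seteqP; split=> [v [[cv psdv] rkv]|_ [p Ap <-]].
  by have [p pv] := gram_repr_surj psdv rkv; exists p => //; apply/csA; rewrite pv.
split; last exact: gram_repr_rank.
by split; [exact/csA|exact: gram_repr_psd].
Qed.

Lemma formulates_image obj (S : set (FG R n N)) :
  S = [set gram_repr pairing B p | p in pep_feasible pairing Fc EQ Init] ->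
  (forall p, obj (gram_repr pairing B p) = (Perf p)%:E) ->
  formulates pairing B Fc EQ Init Perf obj S.
Proof.
move=> SE objE; split=> //; rewrite SE image_comp /worst_case_value.
by congr ereal_sup; apply: eq_imagel => p _; rewrite /= objE.
Qed.

End GramProgram.

(** * From the image of the feasible points to the three formulations *)

Theorem proposition2p6 (R : realType) (E Es : vectType R) (d : nat)
    (dimE : \dim {:E} = d)
    (pairing : {bilinear Es -> E -> R | *%R & *%R})
    (pairing_nd : nondegenerate_pairing pairing)
    (B : 'Hom(E, Es))
    (B_sa : self_adjoint pairing B) (B_pd : positive_definite pairing B)
    (n N : nat) (n_ge1 : (1 <= n)%N)
    (Fc : 'I_n -> set (E -> \bar R))
    (Fc_convex : forall k F, Fc k F -> convex_on setT F)
    (EQ : method_equations E Es n)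
    (Perf : performance_measure E Es n N)
    (Init : initial_condition E Es n N)
    (cF : 'I_n -> seq (FG R n N -> \bar R))
    (cM cI : seq (FG R n N -> \bar R))
    (obj : FG R n N -> \bar R)
    (cF_repr : forall k,
       gram_represents pairing B (class_condition pairing Fc k) (cF k))
    (cM_repr : gram_represents pairing B (method_condition EQ) cM)
    (cI_repr : gram_represents pairing B (init_condition Init) cI)
    (obj_repr : gram_represents_measure pairing B Perf obj) :
  let Q := pep_program cF cM cI obj in
  [/\ (* (i) *)
      ((n + 1) * (N + 2) <= d)%N ->
        convex_program Q /\
        formulates pairing B Fc EQ Init Perf (gp_obj Q) (gp_feasible Q),
      (* (ii) *)
      (d < (n + 1) * (N + 2))%N ->
        convex_program Q /\
        formulates pairing B Fc EQ Init Perf (gp_obj Q)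
          (gp_feasible Q `&` rank_at_most d)
    & (* (iii) *)
      forall (lF : 'I_n -> seq (FG R n N -> \bar R))
             (lM lI : seq (FG R n N -> \bar R)) (lobj : FG R n N -> \bar R),
        (forall k, linearly_gram_represents pairing B
                     (class_condition pairing Fc k) (lF k)) ->
        linearly_gram_represents pairing B (method_condition EQ) lM ->
        linearly_gram_represents pairing B (init_condition Init) lI ->
        linearly_gram_represents_measure pairing B Perf lobj ->
        let L := pep_program lF lM lI lobj in
        exists (S : finType) (a : S -> R) (b : S -> 'cV[R]_(n * N.+2))
               (D : S -> 'M[R]_(n.+1 * N.+2))
               (c : 'cV[R]_(n * N.+2)) (C : 'M[R]_(n.+1 * N.+2)),
          [/\ C \is symmetricmx, forall i, D i \is symmetricmx,
              gp_feasible L = sdp_feasible a b D,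
              forall v, sym_domain v -> gp_obj L v = sdp_objective c C v
            & (((n + 1) * (N + 2) <= d)%N ->
                 formulates pairing B Fc EQ Init Perf
                   (sdp_objective c C) (sdp_feasible a b D)) /\
              ((d < (n + 1) * (N + 2))%N ->
                 formulates pairing B Fc EQ Init Perf
                   (sdp_objective c C) (sdp_feasible a b D `&` rank_at_most d))]].
Proof.
subst d => Q.
(* The matrix has only [(n + 1) * (N + 2)] rows, so the rank bound is vacuous in this range. *)
have rank_full : ((n + 1) * (N + 2) <= \dim {:E})%N ->
    @rank_at_most R n N (\dim {:E}) = setT.
  rewrite addn1 addn2 => md; apply/seteqP; split=> // v _.
  exact: leq_trans (rank_leq_row _) md.
(* Stated for arbitrary constraint lists, to serve both the convex representations and the linear
   ones. *)
have image cF' cM' cI' obj' :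
    (forall k, gram_represents pairing B (class_condition pairing Fc k) (cF' k)) ->
    gram_represents pairing B (method_condition EQ) cM' ->
    gram_represents pairing B (init_condition Init) cI' ->
    gp_feasible (pep_program cF' cM' cI' obj') `&` @rank_at_most R n N (\dim {:E}) =
      [set gram_repr pairing B p | p in pep_feasible pairing Fc EQ Init].
  move=> cF'E [_ cM'E] [_ cI'E]; apply: gp_feasible_image => //.
  by apply: gp_cons_feasible => // k; case: (cF'E k).
(* This covers the optimality constraints and makes every linear representation a convex one. *)
have affine_convex := List.Forall_impl (convex_on (@sym_domain R n N))
  (@affine_constraint_convex R n N).
have Qconvex : convex_program Q.
  split; first by case: obj_repr.
  apply: Forall_gp_cons => [k|||]; [by case: (cF_repr k)|by case: cM_repr| |].
    by case: cI_repr.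
  exact/affine_convex/optimality_constraints_affine.
have Qformulates : formulates pairing B Fc EQ Init Perf (gp_obj Q)
    (gp_feasible Q `&` rank_at_most (\dim {:E})).
  by apply: formulates_image; [exact: image|case: obj_repr].
split=> [/rank_full rk|_|lF lM lI lobj lFE lME lIE [lobj_lin lobjE] L] //.
  by split=> //; rewrite -[gp_feasible Q]setIT -rk.
have [c [C [Csym lobj_sdp]]] := lobj_lin.
have [|S [a [b [D [Dsym LE]]]]] := @satisfies_affine R n N (gp_cons L).
  apply: Forall_gp_cons => [k|||]; [by case: (lFE k)|by case: lME|by case: lIE|].
  exact: optimality_constraints_affine.
have Lsdp : gp_feasible L = sdp_feasible a b D.
  (* The affine formulas in [LE] hold on symmetric matrices only; semidefiniteness includes
     symmetry. *)
  by apply/seteqP; split=> v [cv psdv]; split=> //; apply/LE => //; case: psdv.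
have Lformulates : formulates pairing B Fc EQ Init Perf (sdp_objective c C)
    (sdp_feasible a b D `&` rank_at_most (\dim {:E})).
  apply: formulates_image => [|p].
    rewrite -Lsdp; apply: image => [k||].
    - by case: (lFE k) => ? ?; split=> //; exact: affine_convex.
    - by case: lME => ? ?; split=> //; exact: affine_convex.
    - by case: lIE => ? ?; split=> //; exact: affine_convex.
  rewrite -lobjE lobj_sdp //.
  by case: (gram_repr_psd pairing_nd B_sa B_pd p).
exists S, a, b, D, c, C; split=> //; split=> // /rank_full rk.
by rewrite -[sdp_feasible _ _ _]setIT -rk.
Qed.
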